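(* Let $G_2$ be a simple non-abelian group which acts trivially on an abelian group $G_1$, and let $\varepsilon_1,\varepsilon_2\in Z^2(G_2,G_1)$. Then the groups $G_1\underset{\varepsilon_1}{\times}G_2$ and $G_1\underset{\varepsilon_2}{\times}G_2$ are isomorphic if and only if they are upper isomorphic.
   Context: Groups are written multiplicatively. For a group $G_2$ acting trivially on an abelian group $G_1$, $Z^2(G_2,G_1)$ is the set of normalized 2-cocycles: maps $\varepsilon:G_2\times G_2\to G_1$ with $\varepsilon(h,g)\varepsilon(hg,k)=\varepsilon(g,k)\varepsilon(h,gk)$ for all $g,h,k\in G_2$ and $\varepsilon(g,1)=\varepsilon(1,g)=1$ for all $g\in G_2$. For $\varepsilon\in Z^2(G_2,G_1)$, the central extension $G_1\underset{\varepsilon}{\times}G_2$ is the set $G_1\times G_2$ with the group operation $(x,y)(x',y')=(xx'\varepsilon(y,y'),yy')$. The group $G_1$ is identified with the central subgroup $G_1\times\{1\}$. The groups $G_1\underset{\varepsilon_1}{\times}G_2$ and $G_1\underset{\varepsilon_2}{\times}G_2$ are called upper isomorphic if there exists an isomorphism $\varphi:G_1\underset{\varepsilon_1}{\times}G_2\to G_1\underset{\varepsilon_2}{\times}G_2$ leaving $G_1$ invariant, i.e. $\varphi(G_1\times\{1\})=G_1\times\{1\}$. *)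

(* Defs.v *)
From HB Require Import structures.
From mathcomp Require Import all_boot.
From mathcomp Require Import classical_sets.

Set Implicit Arguments.
Unset Strict Implicit.
Unset Printing Implicit Defensive.

Local Open Scope classical_set_scope.
Local Open Scope group_scope.

HB.mixin Record Group_isAbelian G of Group G := {
  mulgC : commutative (@mul G)
}.

#[short(type="abelianGroupType")]
HB.structure Definition AbelianGroup := {G of Group_isAbelian G & Group G}.

(* Subgroups are Prop-valued sets, so that simplicity of an infinite group     *)
(* quantifies over all of its subgroups, not only over the decidable ones.     *)
Definition subgroup (G : groupType) (N : set G) : Prop :=
  [/\ N 1, forall x y, N x -> N y -> N (x * y) & forall x, N x -> N x^-1].

Definition normal_subgroup (G : groupType) (N : set G) : Prop :=
  subgroup N /\ forall x y, N x -> N (x ^ y).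

Definition simple_group (G : groupType) : Prop :=
  [set: G] <> [set 1] /\
  forall N : set G, normal_subgroup N -> N = [set 1] \/ N = [set: G].

Definition isomorphic (G H : groupType) : Prop :=
  exists f : {multiplicative G -> H}, bijective f.

(* Z^2(G2, G1) for the trivial action of G2 on G1: triviality of the action is *)
(* what makes the first factor on the right-hand side eps g k rather than the  *)
(* image of eps g k under h.                                                   *)
Record cocycle (G2 : groupType) (G1 : abelianGroupType) := Cocycle {
  cocycle_fun :> G2 -> G2 -> G1;
  cocycleM : forall g h k : G2,
    cocycle_fun h g * cocycle_fun (h * g) k
    = cocycle_fun g k * cocycle_fun h (g * k);
  cocycleg1 : forall g : G2, cocycle_fun g 1 = 1;
  cocycle1g : forall g : G2, cocycle_fun 1 g = 1
}.

(* An alias of G1 * G2, since the product type itself already carries the      *)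
(* direct product group structure.                                             *)
Definition central_extension (G2 : groupType) (G1 : abelianGroupType)
  (eps : cocycle G2 G1) : Type := (G1 * G2)%type.

Section CentralExtension.
Variables (G2 : groupType) (G1 : abelianGroupType) (eps : cocycle G2 G1).
Implicit Types u v w : central_extension eps.

HB.instance Definition _ :=
  Choice.copy (central_extension eps) (G1 * G2)%type.

Definition cext_one : central_extension eps := (1, 1).

Definition cext_mul u v : central_extension eps :=
  (u.1 * v.1 * eps u.2 v.2, u.2 * v.2).

Definition cext_inv u : central_extension eps :=
  (u.1^-1 * (eps u.2 u.2^-1)^-1, u.2^-1).

Lemma cext_mulA : associative cext_mul.
Proof.
move=> u v w; rewrite /cext_mul /=; congr (_, _); last by rewrite mulgA.
have mulgAC (x y z : G1) : x * y * z = x * z * y.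
  by rewrite -!mulgA (mulgC y).
rewrite -[RHS]mulgA (mulgC w.1) !mulgA -[X in _ = X * _]mulgA cocycleM.
by rewrite [RHS]mulgAC !mulgA.
Qed.

Lemma cext_mul1 : left_id cext_one cext_mul.
Proof. by case=> x y; rewrite /cext_mul /= cocycle1g !mul1g mulg1. Qed.

Lemma cext_mulr1 : right_id cext_one cext_mul.
Proof. by case=> x y; rewrite /cext_mul /= cocycleg1 !mulg1. Qed.

Lemma cext_mulV : left_inverse cext_one cext_inv cext_mul.
Proof.
case=> x y; rewrite /cext_mul /cext_inv /cext_one /= mulVg; congr (_, _).
have -> : eps y^-1 y = eps y y^-1.
  have := cocycleM eps y^-1 y y.
  by rewrite mulgV mulVg cocycle1g cocycleg1 !mulg1.
by rewrite -mulgA (mulgC x) mulgA mulgVK mulVg.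
Qed.

Lemma cext_mulrV : right_inverse cext_one cext_inv cext_mul.
Proof.
case=> x y; rewrite /cext_mul /cext_inv /cext_one /= mulgV; congr (_, _).
by rewrite mulgA mulgVK mulgV.
Qed.

HB.instance Definition _ := isGroup.Build (central_extension eps)
  cext_mulA cext_mul1 cext_mulr1 cext_mulV cext_mulrV.

Definition central_factor : set (central_extension eps) := [set u | u.2 = 1].

End CentralExtension.

Arguments central_factor {G2 G1} eps _.

Definition upper_isomorphic (G2 : groupType) (G1 : abelianGroupType)
  (eps1 eps2 : cocycle G2 G1) : Prop :=
  exists f : {multiplicative central_extension eps1 -> central_extension eps2},
    bijective f /\ f @` central_factor eps1 = central_factor eps2.

(* Main.v *)
Require Import Defs.
From HB Require Import structures.
From mathcomp Require Import all_boot.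
From mathcomp Require Import classical_sets.

Set Implicit Arguments.
Unset Strict Implicit.
Unset Printing Implicit Defensive.

Local Open Scope classical_set_scope.
Local Open Scope group_scope.

(** Every isomorphism of groups carries center to center, so it suffices to
    recognise the copy of [G1] inside each extension as its center.  It is
    central because the cocycle is normalized and [G1] is abelian.  Conversely
    the second component of a central element is central in [G2], and the
    center of [G2], being a proper normal subgroup of a simple group, is
    trivial.  Hence any isomorphism between the extensions is already upper. *)

Definition group_center (G : groupType) : set G :=
  [set z | forall x, commute z x].

Lemma group_center_normal (G : groupType) : normal_subgroup (@group_center G).
Proof.
split; first split.
- by move=> x; apply/commute_sym/commute1.
- by move=> y z Zy Zz x; apply/commute_sym/commuteM; apply/commute_sym.
- by move=> z Zz x; apply/commute_sym/commuteV/commute_sym.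
- move=> z y Zz; suff -> : z ^ y = z by [].
  by rewrite conjgE (Zz y) mulgA mulVg mul1g.
Qed.

Lemma group_center_simple (G : groupType) :
  simple_group G -> ~ commutative (@mul G) -> @group_center G = [set 1].
Proof.
move=> [_ simpleG] nabG; case: (simpleG _ (@group_center_normal G)) => // ZG.
by case: nabG => x y; have /(_ y) : group_center x by rewrite ZG.
Qed.

Lemma group_center_iso (G H : groupType) (f : {multiplicative G -> H}) :
  bijective f -> f @` @group_center G = @group_center H.
Proof.
move=> [g fK gK]; apply/seteqP; split=> [_ [z Zz <-] x|z Zz].
  by rewrite -[x]gK /commute -!gmulfM Zz.
exists (g z); last exact: gK.
by move=> x; apply: (can_inj fK); rewrite !gmulfM gK Zz.
Qed.

(** Triviality of the center of [G2] forces central elements into the fibre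
    over [1]; elements of that fibre are central because a normalized cocycle
    contributes nothing when either argument is [1]. *)
Lemma group_center_cext (G2 : groupType) (G1 : abelianGroupType)
    (eps : cocycle G2 G1) :
  @group_center G2 = [set 1] ->
  @group_center (central_extension eps) = central_factor eps.
Proof.
move=> Z2; apply/seteqP; split=> [[a y] Zay|[a y] y1 [b z]].
  suff : group_center y by rewrite Z2.
  (* The projection to [G2] is onto, so [y] inherits centrality from [(a, y)]. *)
  by move=> z; case: (Zay (1, z)).
have {y1}-> : y = 1 := y1.
congr (_, _) => /=; last by rewrite mul1g mulg1.
by rewrite cocycle1g cocycleg1 !mulg1 mulgC.
Qed.

Theorem proposition4p1 (G2 : groupType) (G1 : abelianGroupType)
  (eps1 eps2 : cocycle G2 G1) :
  simple_group G2 -> ~ commutative (@mul G2) ->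
  isomorphic (central_extension eps1) (central_extension eps2)
  <-> upper_isomorphic eps1 eps2.
Proof.
move=> simpleG2 nabG2; have Z2 := group_center_simple simpleG2 nabG2.
split=> [[f bij_f]|[f [bij_f _]]]; exists f => //; split=> //.
by rewrite -!group_center_cext //; apply: group_center_iso.
Qed.
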